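(* Let $\psi$ be a unit speed slant helix in $E^3$ with curvature $\kappa$, whose principal normal vector makes the constant angle $\phi$ with a fixed straight line (the axis of the slant helix); put $n=\cos\phi$, assume $0<|n|<1$, and let $m=\dfrac{n}{\sqrt{1-n^2}}$. Then, in a suitable rectangular coordinate system of $E^3$ (i.e. up to an isometry of $E^3$) and for suitable choices of the constants of integration, the position vector $\psi=(\psi_1,\psi_2,\psi_3)$ is given in the natural representation (arc length $s$) by $$\begin{cases} \psi_1(s)=\dfrac{n}{m}\displaystyle\int\left[\int\kappa(s)\cos\Big[\tfrac{1}{n}\arccos\Big(m\int\kappa(s)\,ds\Big)\Big]ds\right]ds,\\[2mm] \psi_2(s)=\dfrac{n}{m}\displaystyle\int\left[\int\kappa(s)\sin\Big[\tfrac{1}{n}\arccos\Big(m\int\kappa(s)\,ds\Big)\Big]ds\right]ds,\\[2mm] \psi_3(s)=n\displaystyle\int\Big[\int\kappa(s)\,ds\Big]ds, \end{cases}$$ or, in terms of the parameter $\theta=\int\kappa(s)\,ds$, by $$\begin{cases} \psi_1(\theta)=\dfrac{n}{m}\displaystyle\int\frac{1}{\kappa(\theta)}\left[\int\cos\Big[\tfrac{1}{n}\arccos(m\theta)\Big]d\theta\right]d\theta,\\[2mm] \psi_2(\theta)=\dfrac{n}{m}\displaystyle\int\frac{1}{\kappa(\theta)}\left[\int\sin\Big[\tfrac{1}{n}\arccos(m\theta)\Big]d\theta\right]d\theta,\\[2mm] \psi_3(\theta)=n\displaystyle\int\frac{\theta}{\kappa(\theta)}\,d\theta, \end{cases}$$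 or, in terms of the parameter $t=\frac{1}{n}\arccos(m\theta)$, by $$\begin{cases} \psi_1(t)=\dfrac{n^3}{m^3}\displaystyle\int\frac{\sin(nt)}{\kappa(t)}\left[\int\cos(t)\sin(nt)\,dt\right]dt,\\[2mm] \psi_2(t)=\dfrac{n^3}{m^3}\displaystyle\int\frac{\sin(nt)}{\kappa(t)}\left[\int\sin(t)\sin(nt)\,dt\right]dt,\\[2mm] \psi_3(t)=-\dfrac{n^2}{m^2}\displaystyle\int\frac{\sin(nt)\cos(nt)}{\kappa(t)}\,dt. \end{cases}$$
   Context: $E^3$ is $\mathbb{R}^3$ with the usual metric. Curves are defined on an interval, have at least four continuous derivatives, and have nonvanishing curvature $\kappa>0$; $\mathbf{N}$ denotes the principal normal of the Frenet frame. A slant helix is a curve whose principal normal vector makes a constant angle with a fixed straight line, i.e. there is a constant unit vector $\mathbf{d}$ (direction of the axis) with $\langle\mathbf{N},\mathbf{d}\rangle=n=\cos\phi$ along the curve. All integrals are indefinite integrals (antiderivatives). The antiderivative $\theta=\int\kappa(s)\,ds$ is the same wherever it occurs, and its integration constant is among those to be chosen suitably; in particular $|m\theta|<1$ along the curve. $\kappa(\theta)$ and $\kappa(t)$ denote the curvature expressed in the parameters $\theta$ and $t$. Isometries of $E^3$ may be orientation preserving or reversing. *)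

(* Defs.v *)
From Stdlib Require Import Reals.
Open Scope R_scope.

Record E3 : Type := mkE3 { x1 : R; x2 : R; x3 : R }.

Definition dot (u v : E3) : R := x1 u * x1 v + x2 u * x2 v + x3 u * x3 v.
Definition enorm (u : E3) : R := sqrt (dot u u).
Definition scale (a : R) (u : E3) : E3 := mkE3 (a * x1 u) (a * x2 u) (a * x3 u).
Definition sub (u v : E3) : E3 := mkE3 (x1 u - x1 v) (x2 u - x2 v) (x3 u - x3 v).
Definition dist (u v : E3) : R := enorm (sub u v).

(* Orientation may be preserved or reversed; surjectivity is automatic. *)
Definition isometry (F : E3 -> E3) : Prop :=
  forall u v : E3, dist (F u) (F v) = dist u v.

(* Intervals of any kind (open, closed, half-open, bounded or not) that contain
   more than one point. *)
Definition is_interval (D : R -> Prop) : Prop :=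
  (forall a b x : R, D a -> D b -> a <= x <= b -> D x) /\
  (exists a b : R, D a /\ D b /\ a < b).

Definition image (D : R -> Prop) (f : R -> R) : R -> Prop :=
  fun y => exists x : R, D x /\ f x = y.

(* [F] is an indefinite integral of [f] on [D]. The derivative is taken within
   [D], hence it is one-sided at an endpoint belonging to [D]. *)
Definition primitive_on (D : R -> Prop) (f F : R -> R) : Prop :=
  forall x : R, D x -> D_in F f D x.

Fixpoint Ck_on (k : nat) (D : R -> Prop) (f : R -> R) : Prop :=
  match k with
  | O => forall x : R, D x -> continue_in f D x
  | S k' => exists f' : R -> R, primitive_on D f' f /\ Ck_on k' D f'
  end.

Definition Ck_curve (k : nat) (D : R -> Prop) (c : R -> E3) : Prop :=
  Ck_on k D (fun s => x1 (c s)) /\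
  Ck_on k D (fun s => x2 (c s)) /\
  Ck_on k D (fun s => x3 (c s)).

Definition curve_deriv_on (D : R -> Prop) (c c' : R -> E3) : Prop :=
  primitive_on D (fun s => x1 (c' s)) (fun s => x1 (c s)) /\
  primitive_on D (fun s => x2 (c' s)) (fun s => x2 (c s)) /\
  primitive_on D (fun s => x3 (c' s)) (fun s => x3 (c s)).

(* Unit speed curve with unit tangent [T], nonvanishing curvature [kappa] and
   principal normal [N]. *)
Definition unit_speed_curve (D : R -> Prop) (psi T : R -> E3)
    (kappa : R -> R) (N : R -> E3) : Prop :=
  exists T' : R -> E3,
    curve_deriv_on D psi T /\
    curve_deriv_on D T T' /\
    (forall s : R, D s ->
       enorm (T s) = 1 /\
       kappa s = enorm (T' s) /\
       0 < kappa s /\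
       N s = scale (/ kappa s) (T' s)).

Definition slant_helix (D : R -> Prop) (N : R -> E3) (phi : R) : Prop :=
  exists d : E3, enorm d = 1 /\ forall s : R, D s -> dot (N s) d = cos phi.

(* Main.v *)
(* Pairing with the axis d gives <N, d> = n, so theta = <T, d> / n is an
   antiderivative of the curvature. The component of N orthogonal to d has
   constant length q = sqrt (1 - n^2) = n / m and turns around d with angular
   velocity kappa / b, where b = det (T, N, d) and b^2 = q^2 - <T, d>^2 never
   vanishes. Since (1/n) arccos (m theta) has derivative - kappa / |b|, it is
   this polar angle t up to a sign and a constant. In a suitable orthonormal
   frame (e1, e2, d) one gets N = (q cos t, q sin t, n), and integrating kappa N
   twice gives the position vector; the other two representations are changes
   of variable. *)

Require Import Defs.
From Stdlib Require Import Reals Lra ClassicalEpsilon.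
Open Scope R_scope.

(** * Differentiation within a subset of the line *)

Lemma primitive_on_ext (D : R -> Prop) (f f' g g' : R -> R) :
  (forall x, D x -> g x = f x) -> (forall x, D x -> g' x = f' x) ->
  primitive_on D f' f -> primitive_on D g' g.
Proof.
  intros Hf Hf' H x Dx eps Heps.
  destruct (H x Dx eps Heps) as [a [Ha Hlim]].
  exists a; split; [exact Ha|].
  intros y [[Dy yx] Hy]; simpl in *.
  rewrite (Hf x Dx), (Hf y Dy), (Hf' x Dx).
  apply Hlim; repeat split; assumption.
Qed.

Lemma primitive_on_const (D : R -> Prop) (c : R) :
  primitive_on D (fun _ => 0) (fun _ => c).
Proof. intros x _; apply Dconst. Qed.

Lemma primitive_on_plus (D : R -> Prop) (f f' g g' : R -> R) :
  primitive_on D f' f -> primitive_on D g' g ->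
  primitive_on D (fun x => f' x + g' x) (fun x => f x + g x).
Proof. intros Hf Hg x Dx; apply Dadd; auto. Qed.

Lemma primitive_on_mult (D : R -> Prop) (f f' g g' : R -> R) :
  primitive_on D f' f -> primitive_on D g' g ->
  primitive_on D (fun x => f' x * g x + f x * g' x) (fun x => f x * g x).
Proof. intros Hf Hg x Dx; apply Dmult; auto. Qed.

Lemma primitive_on_scal (D : R -> Prop) (a : R) (f f' : R -> R) :
  primitive_on D f' f ->
  primitive_on D (fun x => a * f' x) (fun x => a * f x).
Proof. intros Hf x Dx; apply Dmult_const; auto. Qed.

Lemma primitive_on_comp (D : R -> Prop) (f f' g g' : R -> R) :
  primitive_on D f' f ->
  (forall x, D x -> derivable_pt_lim g (f x) (g' (f x))) ->
  primitive_on D (fun x => f' x * g' (f x)) (fun x => g (f x)).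
Proof.
  intros Hf Hg x Dx eps Heps.
  destruct (Dcomp D no_cond f' g' f g x (Hf x Dx)
    (proj2 (derivable_pt_lim_D_in g g' (f x)) (Hg x Dx)) eps Heps)
    as [a [Ha Hlim]].
  exists a; split; [exact Ha|].
  intros y [[Dy yx] Hy]; apply Hlim; repeat split; auto.
Qed.

Lemma primitive_on_continue (D : R -> Prop) (f f' : R -> R) :
  primitive_on D f' f -> forall x, D x -> continue_in f D x.
Proof. intros Hf x Dx; exact (cont_deriv _ _ _ _ (Hf x Dx)). Qed.

(** An interval with more than one point has no isolated point: from [x] one can move a little
    towards another point [y] of [D]. Limits within [D], hence derivatives, are therefore unique. *)
Lemma interval_adherent (D : R -> Prop) (x : R) :
  is_interval D -> D x -> adhDa (D_x D x) x.
Proof.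
  intros [HD [a [b [Da [Db ab]]]]] Dx r Hr.
  assert (Hy : exists y, D y /\ y <> x).
  { destruct (Req_dec a x) as [E|E]; [exists b|exists a]; split; auto; lra. }
  destruct Hy as [y [Dy yx]].
  assert (P : 0 < Rabs (y - x)).
  { apply Rabs_pos_lt; intro E; apply yx; lra. }
  (* The bound 1 keeps [x + t * (y - x)] between [x] and [y]; the other bound keeps it within
     [r / 2] of [x]. *)
  set (t := Rmin 1 (r / 2 / Rabs (y - x))).
  assert (t1 : t <= 1) by apply Rmin_l.
  assert (tr : t * Rabs (y - x) <= r / 2).
  { apply Rmult_le_reg_r with (/ Rabs (y - x)); [now apply Rinv_0_lt_compat|].
    rewrite Rmult_assoc, Rinv_r, Rmult_1_r by lra. apply Rmin_r. }
  assert (t0 : 0 < t).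
  { apply Rmin_pos; [lra|]. apply Rdiv_lt_0_compat; lra. }
  exists (x + t * (y - x)).
  split; [split|].
  - destruct (Rle_or_lt x y).
    + apply (HD x y); auto; split; nra.
    + apply (HD y x); auto; split; nra.
  - intro E. assert (t * (y - x) = 0) by lra.
    destruct (Rmult_integral _ _ H); lra.
  - unfold Rdist. replace (x + t * (y - x) - x) with (t * (y - x)) by ring.
    rewrite Rabs_mult, (Rabs_pos_eq t) by lra. lra.
Qed.

Lemma primitive_on_unique (D : R -> Prop) (f g F : R -> R) :
  is_interval D -> primitive_on D f F -> primitive_on D g F ->
  forall x, D x -> f x = g x.
Proof.
  intros HD Hf Hg x Dx.
  exact (single_limit _ _ _ _ _ (interval_adherent D x HD Dx) (Hf x Dx) (Hg x Dx)).
Qed.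

(** * Mean value theorem and constant sign on an interval of any kind *)

(* Precomposing with [clamp a b] turns one-sided regularity on [[a, b]] into
   two-sided regularity, as needed by the theorems on functions on R. *)
Definition clamp (a b x : R) : R := Rmax a (Rmin b x).

Lemma clamp_id (a b x : R) : a <= x <= b -> clamp a b x = x.
Proof. intros; unfold clamp. rewrite Rmin_right, Rmax_right; lra. Qed.

Lemma clamp_bounds (a b x : R) : a <= b -> a <= clamp a b x <= b.
Proof.
  intro ab; unfold clamp; split; [apply Rmax_l|].
  apply Rmax_lub; [exact ab|apply Rmin_l].
Qed.

Lemma clamp_lipschitz (a b x y : R) :
  Rabs (clamp a b x - clamp a b y) <= Rabs (x - y).
Proof.
  unfold clamp, Rmax, Rmin, Rabs; repeat destruct Rle_dec;
  repeat destruct Rcase_abs; lra.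
Qed.

Lemma continuity_clamp (D : R -> Prop) (f : R -> R) (a b : R) :
  is_interval D -> (forall x, D x -> continue_in f D x) ->
  D a -> D b -> a <= b -> continuity (fun x => f (clamp a b x)).
Proof.
  intros [HD _] Hf Da Db ab x eps Heps.
  assert (Dc : forall y, D (clamp a b y)).
  { intro y; apply (HD a b); auto; now apply clamp_bounds. }
  destruct (Hf _ (Dc x) eps Heps) as [r [Hr Hlim]].
  exists r; split; [exact Hr|].
  intros y [_ Hy]; simpl in *; unfold Rdist in *.
  (* [continue_in] is a limit over points other than the centre, so the case where clamping merges
     [x] and [y] is separate. *)
  destruct (Req_dec (clamp a b y) (clamp a b x)) as [E|E].
  - rewrite E, Rminus_diag, Rabs_R0; exact Heps.
  - apply Hlim; repeat split; auto.
    eapply Rle_lt_trans; [apply clamp_lipschitz|exact Hy].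
Qed.

Lemma primitive_on_MVT (D : R -> Prop) (f f' : R -> R) (a b : R) :
  is_interval D -> primitive_on D f' f -> D a -> D b -> a < b ->
  exists c, D c /\ f b - f a = f' c * (b - a).
Proof.
  intros HD Hf Da Db ab.
  set (g := fun x => f (clamp a b x)).
  assert (Hg : forall c, a < c < b -> derivable_pt_lim g c (f' c)).
  { intros c Hc eps Heps.
    assert (Dc : D c) by (apply (proj1 HD a b); auto; lra).
    destruct (Hf c Dc eps Heps) as [r [Hr Hlim]].
    (* This radius keeps [c + h] strictly between [a] and [b], where [clamp] is the identity. *)
    assert (Hr' : 0 < Rmin r (Rmin (c - a) (b - c))).
    { repeat apply Rmin_pos; lra. }
    exists (mkposreal _ Hr'); intros h h0 Hh; simpl in Hh.
    assert (Rabs h < r) by (eapply Rlt_le_trans; [exact Hh|apply Rmin_l]).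
    assert (Rabs h < c - a).
    { eapply Rlt_le_trans; [exact Hh|].
      eapply Rle_trans; [apply Rmin_r|apply Rmin_l]. }
    assert (Rabs h < b - c).
    { eapply Rlt_le_trans; [exact Hh|].
      eapply Rle_trans; [apply Rmin_r|apply Rmin_r]. }
    assert (a < c + h < b).
    { unfold Rabs in *; destruct Rcase_abs; lra. }
    unfold g; rewrite !clamp_id by lra.
    replace ((f (c + h) - f c) / h)
      with ((f (c + h) - f c) / (c + h - c)) by (f_equal; ring).
    apply (Hlim (c + h)); simpl; unfold Rdist; repeat split.
    - apply (proj1 HD a b); auto; lra.
    - lra.
    - replace (c + h - c) with h by ring; assumption. }
  assert (Hgc : continuity g).
  { apply (continuity_clamp D); auto; [|lra].
    now apply primitive_on_continue with f'. }
  destruct (MVT g id a b (fun c Hc => exist _ _ (Hg c Hc))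
    (fun c _ => derivable_pt_id c) ab (fun c _ => Hgc c)
    (fun c _ => derivable_continuous _ derivable_id c)) as [c [Hc E]].
  exists c; split; [apply (proj1 HD a b); auto; lra|].
  rewrite derive_pt_id in E; simpl in E; unfold id, g in E.
  rewrite !clamp_id in E by lra; lra.
Qed.

Lemma primitive_on_zero (D : R -> Prop) (f : R -> R) :
  is_interval D -> primitive_on D (fun _ => 0) f ->
  forall x y, D x -> D y -> f x = f y.
Proof.
  intros HD Hf x y Dx Dy.
  destruct (Rtotal_order x y) as [H|[->|H]]; [|reflexivity|].
  - destruct (primitive_on_MVT D f _ x y HD Hf Dx Dy H) as [c [_ E]]; lra.
  - destruct (primitive_on_MVT D f _ y x HD Hf Dy Dx H) as [c [_ E]]; lra.
Qed.

(** By the intermediate value theorem a change of sign would produce a zero. The sign is given as a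
    number [e] with square 1, so that it can enter formulas as a factor. *)
Lemma continuous_constant_sign (D : R -> Prop) (f : R -> R) :
  is_interval D -> (forall x, D x -> continue_in f D x) ->
  (forall x, D x -> f x <> 0) ->
  exists e, e * e = 1 /\ forall x, D x -> 0 < e * f x.
Proof.
  intros HD Hf f0.
  assert (S : forall x y, D x -> D y -> x <= y -> 0 < f x * f y).
  { intros x y Dx Dy xy.
    destruct (Rlt_or_le 0 (f x * f y)) as [P|P]; [exact P|exfalso].
    destruct (IVT_cor (fun z => f (clamp x y z)) x y) as [z [Hz E]].
    - now apply (continuity_clamp D).
    - exact xy.
    - cbv beta; rewrite !clamp_id by lra; exact P.
    - rewrite clamp_id in E by exact Hz.
      apply (f0 z); [apply (proj1 HD x y); auto|exact E]. }
  destruct HD as [HD [a [_ [Da _]]]].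
  assert (S' : forall x, D x -> 0 < f a * f x).
  { intros x Dx. destruct (Rle_or_lt a x) as [H|H].
    - now apply S.
    - rewrite Rmult_comm; apply S; auto; lra. }
  destruct (Rlt_or_le 0 (f a)) as [P|P].
  - exists 1; split; [ring|]. intros x Dx; specialize (S' x Dx); nra.
  - exists (-1); split; [ring|]. intros x Dx; specialize (S' x Dx); nra.
Qed.

(** * Inverses of strictly monotone functions and change of variable *)

Definition strictly_increasing_on (D : R -> Prop) (h : R -> R) : Prop :=
  forall x y, D x -> D y -> x < y -> h x < h y.

Lemma primitive_on_increasing (D : R -> Prop) (h h' : R -> R) :
  is_interval D -> primitive_on D h' h -> (forall x, D x -> 0 < h' x) ->
  strictly_increasing_on D h.
Proof.
  intros HD Hh P x y Dx Dy xy.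
  destruct (primitive_on_MVT D h h' x y HD Hh Dx Dy xy) as [c [Dc E]].
  specialize (P c Dc); nra.
Qed.

(** Continuity of the inverse at [h s], stated without naming the inverse. It follows from
    monotonicity: the values of [h] at [s + r / 2] and [s - r / 2] serve as barriers. *)
Lemma increasing_inverse_continuous (D : R -> Prop) (h : R -> R) (s r : R) :
  is_interval D -> strictly_increasing_on D h -> D s -> 0 < r ->
  exists r', 0 < r' /\
    forall x, D x -> Rabs (h x - h s) < r' -> Rabs (x - s) < r.
Proof.
  intros [HD _] Hh Ds Hr.
  assert (U : exists r', 0 < r' /\
    forall x, D x -> h x - h s < r' -> x - s < r).
  { destruct (classic (D (s + r / 2))) as [Dy|Dy].
    - exists (h (s + r / 2) - h s).
      split; [apply Rlt_0_minus, Hh; auto; lra|].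
      intros x Dx Hx. destruct (Rlt_or_le x (s + r)) as [xr|xr]; [lra|].
      assert (h (s + r / 2) < h x) by (apply Hh; auto; lra). lra.
    (* If [s + r / 2] is outside the interval, [D] has no point beyond it and any positive bound
       will do. *)
    - exists 1; split; [lra|]. intros x Dx _.
      destruct (Rlt_or_le x (s + r)) as [xr|xr]; [lra|].
      destruct Dy; apply (HD s x); auto; lra. }
  assert (L : exists r', 0 < r' /\
    forall x, D x -> h s - h x < r' -> s - x < r).
  { destruct (classic (D (s - r / 2))) as [Dy|Dy].
    - exists (h s - h (s - r / 2)).
      split; [apply Rlt_0_minus, Hh; auto; lra|].
      intros x Dx Hx. destruct (Rlt_or_le (s - r) x) as [xr|xr]; [lra|].
      assert (h x < h (s - r / 2)) by (apply Hh; auto; lra). lra.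
    - exists 1; split; [lra|]. intros x Dx _.
      destruct (Rlt_or_le (s - r) x) as [xr|xr]; [lra|].
      destruct Dy; apply (HD x s); auto; lra. }
  destruct U as [r1 [Hr1 U]], L as [r2 [Hr2 L]].
  exists (Rmin r1 r2); split; [now apply Rmin_pos|].
  intros x Dx Hx.
  pose proof (Rmin_l r1 r2); pose proof (Rmin_r r1 r2).
  apply Rabs_def2 in Hx.
  apply Rabs_def1; [apply U|apply Ropp_lt_cancel; rewrite Ropp_involutive,
    Ropp_minus_distr; apply L]; auto; lra.
Qed.

Definition strictly_monotone_on (D : R -> Prop) (h : R -> R) : Prop :=
  strictly_increasing_on D h \/ strictly_increasing_on D (fun x => - h x).

Lemma monotone_inverse_continuous (D : R -> Prop) (h : R -> R) (s r : R) :
  is_interval D -> strictly_monotone_on D h -> D s -> 0 < r ->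
  exists r', 0 < r' /\
    forall x, D x -> Rabs (h x - h s) < r' -> Rabs (x - s) < r.
Proof.
  intros HD [Hh|Hh] Ds Hr;
  destruct (increasing_inverse_continuous D _ s r HD Hh Ds Hr) as [r' [Hr' H]];
  exists r'; (split; [exact Hr'|]); auto.
  intros x Dx Hx; apply H; [exact Dx|].
  replace (- h x - - h s) with (- (h x - h s)) by ring.
  now rewrite Rabs_Ropp.
Qed.

(** Monotonicity makes the preimage unique, so choice selects it. The inverse is a total function
    whose values off the image of [D] are arbitrary. *)
Lemma monotone_left_inverse (D : R -> Prop) (h : R -> R) :
  strictly_monotone_on D h -> exists g, forall s, D s -> g (h s) = s.
Proof.
  intro Hh.
  exists (fun v => epsilon (inhabits 0) (fun s => D s /\ h s = v)).
  intros s Ds.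
  destruct (epsilon_spec (inhabits 0) (fun x => D x /\ h x = h s)) as [Dx E];
    [now exists s|].
  set (x := epsilon _ _) in *.
  destruct (Rtotal_order x s) as [H|[H|H]]; [exfalso|exact H|exfalso];
  destruct Hh as [Hh|Hh]; apply Hh in H; auto; lra.
Qed.

(** Substitution rule for [u = h s]. The difference quotient in [u] is the quotient of those of [G]
    and [h] in [s], and continuity of the inverse carries the limit over. *)
Lemma primitive_on_reparam (D : R -> Prop) (h h' sigma g G k : R -> R) :
  is_interval D -> strictly_monotone_on D h -> primitive_on D h' h ->
  (forall s, D s -> h' s <> 0) -> (forall s, D s -> sigma (h s) = s) ->
  primitive_on D g G -> (forall s, D s -> k (h s) = g s / h' s) ->
  primitive_on (image D h) k (fun u => G (sigma u)).
Proof.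
  intros HD Hm Hh h0 Hs HG Hk u [s [Ds <-]] eps Heps.
  assert (Hlim := limit_mul _ _ _ _ _ _ (HG s Ds)
    (limit_inv _ _ _ _ (Hh s Ds) (h0 s Ds))).
  destruct (Hlim eps Heps) as [r [Hr H]].
  destruct (monotone_inverse_continuous D h s r HD Hm Ds Hr) as [r' [Hr' Hinv]].
  exists r'; split; [exact Hr'|].
  intros v [[[x [Dx <-]] xs] Hx]; simpl in *; unfold Rdist in *.
  assert (x <> s) by (intros ->; now apply xs).
  assert (h x <> h s) by auto.
  rewrite !Hs, Hk by assumption.
  replace ((G x - G s) / (h x - h s))
    with ((G x - G s) / (x - s) * / ((h x - h s) / (x - s)))
    by (field; lra).
  apply H; repeat split; auto.
Qed.

(** * Higher derivatives, vector identities and differentiation of curves *)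

(** [Ck_on] only asserts that some derivatives exist; uniqueness identifies them on [D] with the
    given [f1] and [f2], which thus inherit the regularity. *)
Lemma Ck_on_derive2 (k : nat) (D : R -> Prop) (f f1 f2 : R -> R) :
  is_interval D -> Ck_on (3 + k) D f ->
  primitive_on D f1 f -> primitive_on D f2 f1 ->
  exists f3, primitive_on D f3 f2.
Proof.
  intros HD [g1 [H1 [g2 [H2 [g3 [H3 _]]]]]] Hf1 Hf2.
  assert (E1 := primitive_on_unique D f1 g1 f HD Hf1 H1).
  assert (H2' : primitive_on D g2 f1) by (apply (primitive_on_ext D g1 g2); auto).
  assert (E2 := primitive_on_unique D f2 g2 f1 HD Hf2 H2').
  exists g3; apply (primitive_on_ext D g2 g3); auto.
Qed.

Definition add (u v : E3) : E3 := mkE3 (x1 u + x1 v) (x2 u + x2 v) (x3 u + x3 v).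

Definition cross (u v : E3) : E3 :=
  mkE3 (x2 u * x3 v - x3 u * x2 v)
       (x3 u * x1 v - x1 u * x3 v)
       (x1 u * x2 v - x2 u * x1 v).

Lemma dot_self_pos (u : E3) : 0 <= dot u u.
Proof. unfold dot; nra. Qed.

Lemma dot_self_enorm (u : E3) : dot u u = enorm u * enorm u.
Proof. unfold enorm; rewrite sqrt_sqrt; [reflexivity|apply dot_self_pos]. Qed.

Lemma dot_comm (u v : E3) : dot u v = dot v u.
Proof. unfold dot; ring. Qed.

Lemma dot_scale_l (a : R) (u v : E3) : dot (scale a u) v = a * dot u v.
Proof. unfold dot, scale; simpl; ring. Qed.

Lemma dot_add_l (u v w : E3) : dot (add u v) w = dot u w + dot v w.
Proof. unfold dot, add; simpl; ring. Qed.

Lemma dot_sub_l (u v w : E3) : dot (sub u v) w = dot u w - dot v w.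
Proof. unfold dot, sub; simpl; ring. Qed.

(** The squared triple product is the Gram determinant, here expanded along its first row. *)
Lemma gram_det (u v w : E3) :
  dot u (cross v w) * dot u (cross v w) =
    dot u u * (dot v v * dot w w - dot v w * dot v w)
    - dot u v * (dot u v * dot w w - dot v w * dot u w)
    + dot u w * (dot u v * dot v w - dot v v * dot u w).
Proof. unfold dot, cross; simpl; ring. Qed.

(** Expansion of [x] in the basis reciprocal to [u], [v], [w], cleared of the determinant and paired
    with [y]. *)
Lemma cramer_expansion (u v w x y : E3) :
  dot u (cross v w) * dot x y =
    dot x u * dot (cross v w) y + dot x v * dot (cross w u) y
    + dot x w * dot (cross u v) y.
Proof. unfold dot, cross; simpl; ring. Qed.

Lemma curve_deriv_const (D : R -> Prop) (w : E3) :
  curve_deriv_on D (fun _ => w) (fun _ => mkE3 0 0 0).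
Proof. repeat split; simpl; apply primitive_on_const. Qed.

Lemma curve_deriv_ext (D : R -> Prop) (u u' v v' : R -> E3) :
  (forall s, D s -> v s = u s) -> (forall s, D s -> v' s = u' s) ->
  curve_deriv_on D u u' -> curve_deriv_on D v v'.
Proof.
  intros E E' [H1 [H2 H3]].
  repeat split; [apply (primitive_on_ext D _ _ _ _) with (3 := H1)
    |apply (primitive_on_ext D _ _ _ _) with (3 := H2)
    |apply (primitive_on_ext D _ _ _ _) with (3 := H3)];
  intros s Ds; simpl; rewrite ?E, ?E' by assumption; reflexivity.
Qed.

Lemma primitive_on_dot (D : R -> Prop) (u u' v v' : R -> E3) :
  curve_deriv_on D u u' -> curve_deriv_on D v v' ->
  primitive_on D (fun s => dot (u' s) (v s) + dot (u s) (v' s))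
    (fun s => dot (u s) (v s)).
Proof.
  intros [Hu1 [Hu2 Hu3]] [Hv1 [Hv2 Hv3]].
  eapply primitive_on_ext;
    [| |apply primitive_on_plus; [apply primitive_on_plus|];
        [exact (primitive_on_mult D _ _ _ _ Hu1 Hv1)
        |exact (primitive_on_mult D _ _ _ _ Hu2 Hv2)
        |exact (primitive_on_mult D _ _ _ _ Hu3 Hv3)]];
  intros s _; unfold dot; simpl; ring.
Qed.

Lemma primitive_on_dot_const (D : R -> Prop) (u u' : R -> E3) (w : E3) :
  curve_deriv_on D u u' ->
  primitive_on D (fun s => dot (u' s) w) (fun s => dot (u s) w).
Proof.
  intro Hu.
  eapply primitive_on_ext;
    [| |exact (primitive_on_dot D u u' _ _ Hu (curve_deriv_const D w))];
  intros s _; unfold dot; simpl; ring.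
Qed.

Lemma curve_deriv_scale (D : R -> Prop) (a a' : R -> R) (u u' : R -> E3) :
  primitive_on D a' a -> curve_deriv_on D u u' ->
  curve_deriv_on D (fun s => scale (a s) (u s))
    (fun s => add (scale (a' s) (u s)) (scale (a s) (u' s))).
Proof.
  intros Ha [H1 [H2 H3]].
  repeat split; apply primitive_on_mult; assumption.
Qed.

Lemma derivative_of_constant_on (D : R -> Prop) (f f' : R -> R) (c : R) :
  is_interval D -> primitive_on D f' f -> (forall x, D x -> f x = c) ->
  forall x, D x -> f' x = 0.
Proof.
  intros HD Hf Hc.
  apply (primitive_on_unique D f' (fun _ => 0) f HD Hf).
  apply (primitive_on_ext D (fun _ => c) (fun _ => 0)); auto.
  apply primitive_on_const.
Qed.

(** The normal involves the second derivative of the curve, so a third one is needed; dividing by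
    the norm is harmless because the curvature does not vanish. *)
Lemma principal_normal_derivable (k : nat) (D : R -> Prop)
    (psi T T' : R -> E3) :
  is_interval D -> Ck_curve (3 + k) D psi ->
  curve_deriv_on D psi T -> curve_deriv_on D T T' ->
  (forall s, D s -> 0 < enorm (T' s)) ->
  exists N', curve_deriv_on D (fun s => scale (/ enorm (T' s)) (T' s)) N'.
Proof.
  intros HD [C1 [C2 C3]] [P1 [P2 P3]] [Q1 [Q2 Q3]] Hpos.
  destruct (Ck_on_derive2 k D _ _ _ HD C1 P1 Q1) as [g1 G1].
  destruct (Ck_on_derive2 k D _ _ _ HD C2 P2 Q2) as [g2 G2].
  destruct (Ck_on_derive2 k D _ _ _ HD C3 P3 Q3) as [g3 G3].
  assert (HT' : curve_deriv_on D T' (fun s => mkE3 (g1 s) (g2 s) (g3 s)))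
    by (repeat split; assumption).
  eexists; apply curve_deriv_scale; [|exact HT'].
  (* [/ enorm (T' s)] is the inverse square root of [dot (T' s) (T' s)]; its derivative is written
     in the shape that the quotient rule produces. *)
  eapply (primitive_on_comp D (fun s => dot (T' s) (T' s)) _ (fun y => / sqrt y)
    (fun y => (0 * sqrt y - / (2 * sqrt y) * 1) / Rsqr (sqrt y))).
  - exact (primitive_on_dot D _ _ _ _ HT' HT').
  - intros s Ds.
    assert (P : 0 < dot (T' s) (T' s)).
    { rewrite dot_self_enorm; specialize (Hpos s Ds); nra. }
    eapply derivable_pt_lim_ext;
      [|apply (derivable_pt_lim_div (fct_cte 1) sqrt);
        [apply derivable_pt_lim_const|now apply derivable_pt_lim_sqrt|]].
    + intro y; unfold div_fct, fct_cte, Rdiv; ring.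
    + apply Rgt_not_eq, sqrt_lt_R0; exact P.
Qed.

(** * Plane rotation and orthonormal frames adapted to the axis *)

(** Turning the vector [(p, r)] back through the angle [alpha] cancels its rotation, so the turned
    vector has zero derivative and stays at [(q, 0)]. *)
Lemma planar_rotation (D : R -> Prop) (p r w alpha : R -> R) :
  is_interval D ->
  primitive_on D (fun s => - (w s * r s)) p ->
  primitive_on D (fun s => w s * p s) r ->
  primitive_on D w alpha ->
  forall s0 q, D s0 -> p s0 = q * cos (alpha s0) -> r s0 = q * sin (alpha s0) ->
  forall s, D s -> p s = q * cos (alpha s) /\ r s = q * sin (alpha s).
Proof.
  intros HD Hp Hr Ha s0 q D0 p0 r0 s Ds.
  assert (Hc := primitive_on_comp D alpha w cos (fun x => - sin x) Ha
    (fun x _ => derivable_pt_lim_cos (alpha x))).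
  assert (Hs := primitive_on_comp D alpha w sin cos Ha
    (fun x _ => derivable_pt_lim_sin (alpha x))).
  assert (U : p s * cos (alpha s) + r s * sin (alpha s) =
              p s0 * cos (alpha s0) + r s0 * sin (alpha s0)).
  { apply (primitive_on_zero D
      (fun s => p s * cos (alpha s) + r s * sin (alpha s))); auto.
    eapply primitive_on_ext;
      [| |apply primitive_on_plus; [exact (primitive_on_mult D _ _ _ _ Hp Hc)|
           exact (primitive_on_mult D _ _ _ _ Hr Hs)]];
    intros x _; simpl; ring. }
  assert (V : r s * cos (alpha s) + (-1) * (p s * sin (alpha s)) =
              r s0 * cos (alpha s0) + (-1) * (p s0 * sin (alpha s0))).
  { apply (primitive_on_zero D
      (fun s => r s * cos (alpha s) + (-1) * (p s * sin (alpha s)))); auto.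
    eapply primitive_on_ext;
      [| |apply primitive_on_plus; [exact (primitive_on_mult D _ _ _ _ Hr Hc)|
           exact (primitive_on_scal D (-1) _ _ (primitive_on_mult D _ _ _ _ Hp Hs))]];
    intros x _; simpl; ring. }
  rewrite p0, r0 in U, V.
  pose proof (sin2_cos2 (alpha s)) as S; pose proof (sin2_cos2 (alpha s0)) as S0.
  unfold Rsqr in *.
  assert (U' : p s * cos (alpha s) + r s * sin (alpha s) = q).
  { rewrite U; replace q with (q * 1) at 3 by ring; rewrite <- S0; ring. }
  assert (V' : r s * cos (alpha s) - p s * sin (alpha s) = 0) by lra.
  clear U V p0 r0.
  (* Turning [(q, 0)] forward through [alpha] again recovers [p] and [r]. *)
  split.
  - rewrite <- U'.
    replace (p s) with (p s * (sin (alpha s) * sin (alpha s)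
      + cos (alpha s) * cos (alpha s))) at 1 by (rewrite S; ring).
    apply Rminus_diag_uniq.
    transitivity (- sin (alpha s) * (r s * cos (alpha s) - p s * sin (alpha s)));
      [ring|rewrite V'; ring].
  - rewrite <- U'.
    replace (r s) with (r s * (sin (alpha s) * sin (alpha s)
      + cos (alpha s) * cos (alpha s))) at 1 by (rewrite S; ring).
    apply Rminus_diag_uniq.
    transitivity (cos (alpha s) * (r s * cos (alpha s) - p s * sin (alpha s)));
      [ring|rewrite V'; ring].
Qed.

(** The part [w] of [v] orthogonal to [d] has length [q]. Normalizing [w] and turning it about [d]
    through [-a] gives [e], from which [w] is then seen at angle [a]. *)
Lemma unit_vector_at_angle (v d : E3) (n q a : R) :
  dot v v = 1 -> dot d d = 1 -> dot v d = n -> 0 < q -> q * q = 1 - n * n ->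
  exists e, dot e e = 1 /\ dot d e = 0 /\
    dot v e = q * cos a /\ dot v (cross d e) = q * sin a.
Proof.
  intros Hv Hd Hn Hq Hqq.
  set (w := sub v (scale n d)).
  assert (wd : dot w d = 0).
  { unfold w; rewrite dot_sub_l, dot_scale_l, Hn, Hd; ring. }
  assert (ww : dot w w = q * q).
  { transitivity (dot v w);
      [|unfold w; rewrite dot_comm, dot_sub_l, dot_scale_l, (dot_comm d v);
        rewrite Hv, Hn, Hqq; ring].
    unfold w at 1; rewrite dot_sub_l, dot_scale_l, (dot_comm d w), wd; ring. }
  set (z := cross d w).
  assert (zz : dot z z = q * q).
  { transitivity (dot d d * dot w w - dot w d * dot w d);
      [unfold z, dot, cross; simpl; ring|rewrite Hd, ww, wd; ring]. }
  assert (wz : dot w z = 0) by (unfold z, dot, cross; simpl; ring).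
  assert (dz : dot d z = 0) by (unfold z, dot, cross; simpl; ring).
  assert (vE : forall x, dot v x = dot w x + n * dot d x).
  { intro x; unfold w; rewrite dot_sub_l, dot_scale_l; ring. }
  pose proof (sin2_cos2 a) as S; unfold Rsqr in S.
  exists (scale (/ q) (add (scale (cos a) w) (scale (- sin a) z))).
  assert (L : forall x, dot x (scale (/ q) (add (scale (cos a) w) (scale (- sin a) z)))
    = / q * (cos a * dot x w - sin a * dot x z)).
  { intro x; unfold dot, scale, add; simpl; ring. }
  repeat split.
  - rewrite L, !dot_scale_l, !dot_add_l, !dot_scale_l, (dot_comm z w), ww, wz, zz.
    transitivity (sin a * sin a + cos a * cos a); [field; lra|exact S].
  - rewrite L, (dot_comm d w), wd, dz; ring.
  - rewrite vE, !L, ww, wz, (dot_comm d w), wd, dz; field; lra.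
  - rewrite vE.
    transitivity (/ q * (cos a * dot w z + sin a *
      (dot d d * dot w w - dot w d * dot w d)));
      [unfold z, scale, add, dot, cross; simpl; ring|].
    rewrite wz, Hd, ww, wd; field; lra.
Qed.

(** For orthonormal [d] and [e], [gram_det] turns the squared coordinate along [cross d e] into the
    squared length minus the other two squares. The factor [c] allows both orientations. *)
Lemma orthonormal_frame_isometry (d e : E3) (c : R) :
  dot d d = 1 -> dot e e = 1 -> dot d e = 0 -> c * c = 1 ->
  isometry (fun u => mkE3 (dot u e) (dot u (scale c (cross d e))) (dot u d)).
Proof.
  intros Hd He Hde Hc u v; apply (f_equal sqrt).
  transitivity (dot (sub u v) e * dot (sub u v) e
    + c * c * (dot (sub u v) (cross d e) * dot (sub u v) (cross d e))
    + dot (sub u v) d * dot (sub u v) d).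
  - unfold dot, sub, scale; simpl; ring.
  - rewrite gram_det, Hc, Hd, He, Hde; ring.
Qed.

(** * Rotation of the principal normal about the axis *)

Lemma curve_deriv_cross_const (D : R -> Prop) (u u' : R -> E3) (w : E3) :
  curve_deriv_on D u u' ->
  curve_deriv_on D (fun s => cross (u s) w) (fun s => cross (u' s) w).
Proof.
  intros [H1 [H2 H3]].
  assert (L : forall f f' g g' a b, primitive_on D f' f -> primitive_on D g' g ->
    primitive_on D (fun s => f' s * a - g' s * b) (fun s => f s * a - g s * b)).
  { intros f f' g g' a b Hf Hg.
    eapply primitive_on_ext; [| |apply primitive_on_plus;
      [exact (primitive_on_scal D a _ _ Hf)|
       exact (primitive_on_scal D (- b) _ _ Hg)]];
    intros s _; simpl; ring. }
  split; [|split]; simpl; apply L; assumption.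
Qed.

Lemma derivable_pt_lim_acos (x : R) :
  -1 < x < 1 -> derivable_pt_lim acos x (-1 / sqrt (1 - Rsqr x)).
Proof.
  intro Hx; rewrite <- (derive_pt_acos x Hx).
  apply derive_pt_eq_1 with (derivable_pt_acos x Hx); reflexivity.
Qed.

(* Being orthogonal to N and d, the vector N' is a multiple of d x N; taking the
   dot product with T gives the factor, which replaces the torsion here. *)
Lemma slant_normal_rotation (T N N' d : E3) (k n q : R) :
  dot N N = 1 -> dot d d = 1 -> dot N d = n -> 0 < q -> q * q = 1 - n * n ->
  0 < k -> dot N' N = 0 -> dot N' d = 0 -> dot T N' = - k ->
  dot T (cross N d) <> 0 /\
  forall w, dot N' w = k / dot T (cross N d) * dot (cross d N) w.
Proof.
  intros HN Hd Hn Hq Hqq Hk H1 H2 H3.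
  set (b := dot T (cross N d)).
  assert (K : forall w, b * dot N' w = k * dot (cross d N) w).
  { intro w; unfold b.
    rewrite cramer_expansion, H1, H2, (dot_comm N' T), H3.
    unfold dot, cross; simpl; ring. }
  (* If [b] were zero, testing [K] on [cross d N], of squared length [q * q], would force
     [k * (q * q) = 0]. *)
  assert (b0 : b <> 0).
  { intro b0; specialize (K (cross d N)); rewrite b0 in K.
    assert (dot (cross d N) (cross d N) = q * q).
    { transitivity (dot d d * dot N N - dot N d * dot N d);
        [unfold dot, cross; simpl; ring|rewrite Hd, HN, Hn, Hqq; ring]. }
    assert (0 < k * (q * q)) by (repeat apply Rmult_lt_0_compat; assumption).
    rewrite H in K; lra. }
  split; [exact b0|]. intro w.
  apply Rmult_eq_reg_l with b; [|exact b0].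
  rewrite K; field; exact b0.
Qed.

(** Contains the geometry of the slant helix: it yields explicit coordinates of [N], after which
    only integration remains. The polar angle of [N] about [d] is found by integrating its angular
    velocity [kappa / b]. *)
Lemma slant_helix_frame (D : R -> Prop) (T N N' : R -> E3) (kappa : R -> R)
    (d : E3) (n q m : R) (theta : R -> R) :
  is_interval D ->
  curve_deriv_on D T (fun s => scale (kappa s) (N s)) ->
  curve_deriv_on D N N' ->
  (forall s, D s -> dot (T s) (T s) = 1) ->
  (forall s, D s -> dot (N s) (N s) = 1) ->
  (forall s, D s -> 0 < kappa s) ->
  dot d d = 1 -> (forall s, D s -> dot (N s) d = n) ->
  n <> 0 -> 0 < q -> q * q = 1 - n * n -> m = n / q ->
  (forall s, theta s = dot (T s) d / n) ->
  primitive_on D kappa theta /\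
  (forall s, D s -> Rabs (m * theta s) < 1) /\
  exists (e : E3) (c : R), dot e e = 1 /\ dot d e = 0 /\ c * c = 1 /\
    forall s, D s ->
      dot (N s) e = q * cos (1 / n * acos (m * theta s)) /\
      dot (N s) (scale c (cross d e)) = q * sin (1 / n * acos (m * theta s)).
Proof.
  intros HD HT HN TT NN Hk dd Nd n0 Hq Hqq Hm Hth.
  assert (TN : forall s, D s -> dot (T s) (N s) = 0).
  { intros s Ds.
    pose proof (derivative_of_constant_on D _ _ 1 HD
      (primitive_on_dot D _ _ _ _ HT HT) TT s Ds) as E; cbv beta in E.
    rewrite (dot_comm (T s)), dot_scale_l, (dot_comm (N s)) in E.
    specialize (Hk s Ds); nra. }
  assert (N'N : forall s, D s -> dot (N' s) (N s) = 0).
  { intros s Ds.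
    pose proof (derivative_of_constant_on D _ _ 1 HD
      (primitive_on_dot D _ _ _ _ HN HN) NN s Ds) as E; cbv beta in E.
    rewrite (dot_comm (N s)) in E; lra. }
  assert (N'd := derivative_of_constant_on D _ _ n HD
      (primitive_on_dot_const D _ _ d HN) Nd); cbv beta in N'd.
  assert (TN' : forall s, D s -> dot (T s) (N' s) = - kappa s).
  { intros s Ds.
    pose proof (derivative_of_constant_on D _ _ 0 HD
      (primitive_on_dot D _ _ _ _ HT HN) TN s Ds) as E; cbv beta in E.
    rewrite dot_scale_l, NN in E by exact Ds; lra. }
  set (b := fun s => dot (T s) (cross (N s) d)).
  assert (Rot : forall s, D s -> b s <> 0 /\
    forall w, dot (N' s) w = kappa s / b s * dot (cross d (N s)) w).
  { intros s Ds; apply (slant_normal_rotation _ _ _ _ _ n q); auto. }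
  (* The Gram determinant of [T], [N], [d], whose only nontrivial entries are [n] and
     [dot (T s) d = n * theta s]. *)
  assert (bb : forall s, D s -> b s * b s = q * q - n * theta s * (n * theta s)).
  { intros s Ds; unfold b.
    rewrite gram_det, TT, NN, TN, dd, Nd, Hqq, Hth by exact Ds; field; exact n0. }
  (* Since [b] does not vanish, [n * theta] is smaller than [q] in absolute value, and
     [q * m = n]. *)
  assert (Hbound : forall s, D s -> -1 < m * theta s < 1).
  { intros s Ds; destruct (Rot s Ds) as [b0 _]; specialize (bb s Ds).
    assert (0 < b s * b s) by exact (Rsqr_pos_lt _ b0).
    assert (q * (m * theta s) = n * theta s) by (rewrite Hm; field; lra).
    rewrite <- H0 in bb.
    assert (q * q * (m * theta s * (m * theta s)) < q * q * 1) by lra.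
    apply Rmult_lt_reg_l in H1; nra. }
  assert (Hprim : primitive_on D kappa theta).
  { eapply primitive_on_ext;
      [| |exact (primitive_on_scal D (/ n) _ _ (primitive_on_dot_const D _ _ d HT))].
    - intros s _; cbv beta; rewrite Hth; unfold Rdiv; ring.
    - intros s Ds; cbv beta; rewrite dot_scale_l, Nd by exact Ds; field; exact n0. }
  split; [exact Hprim|split].
  { intros s Ds; apply Rabs_def1; apply Hbound in Ds; lra. }
  destruct (continuous_constant_sign D b HD) as [c [cc Hc]].
  { apply (primitive_on_continue D b _
      (primitive_on_dot D _ _ _ _ HT (curve_deriv_cross_const D _ _ d HN))). }
  { intros s Ds; apply Rot; exact Ds. }
  assert (c0 : c <> 0) by (intros ->; lra).
  assert (Hsqrt : forall s, D s -> sqrt (1 - Rsqr (m * theta s)) = c * b s / q).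
  { intros s Ds.
    replace (1 - Rsqr (m * theta s)) with (Rsqr (c * b s / q)).
    - apply sqrt_Rsqr; left; apply Rdiv_lt_0_compat; auto.
    - transitivity (c * c * (b s * b s) / (q * q));
        [unfold Rsqr; field; lra|].
      rewrite cc, bb, Hm by exact Ds; unfold Rsqr; field; lra. }
  (* With [c] the sign of [b], the derivative of [1 / n * acos (m * theta s)] is
     [- kappa s / (c * b s)]; the factor [- c] turns it into [kappa s / b s]. *)
  set (alpha := fun s => (- c * (1 / n)) * acos (m * theta s)).
  assert (Halpha : primitive_on D (fun s => kappa s / b s) alpha).
  { eapply primitive_on_ext; [| |apply (primitive_on_scal D (- c * (1 / n)));
      apply (primitive_on_comp D (fun s => m * theta s) _ acos
        (fun y => -1 / sqrt (1 - Rsqr y)) (primitive_on_scal D m _ _ Hprim));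
      intros s Ds; apply derivable_pt_lim_acos; auto].
    - reflexivity.
    - intros s Ds; cbv beta; rewrite Hsqrt, Hm by exact Ds.
      destruct (Rot s Ds) as [b0 _]; field; repeat split; auto; lra. }
  destruct (proj2 HD) as [s0 [_ [D0 _]]].
  (* The direction [e] is chosen so that the polar angle of [N] at [s0] is already [alpha s0]; this
     absorbs the constant of integration. *)
  destruct (unit_vector_at_angle (N s0) d n q (alpha s0)) as [e [ee [de [H1 H2]]]];
    auto.
  assert (Turn : forall s, D s ->
    dot (N s) e = q * cos (alpha s) /\ dot (N s) (cross d e) = q * sin (alpha s)).
  { apply (planar_rotation D (fun s => dot (N s) e) (fun s => dot (N s) (cross d e))
      (fun s => kappa s / b s) alpha) with (s0 := s0); auto.
    - apply primitive_on_ext with (3 := primitive_on_dot_const D _ _ e HN);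
        [reflexivity|].
      intros x Dx; cbv beta; destruct (Rot x Dx) as [_ ->].
      transitivity (kappa x / b x * - dot (N x) (cross d e));
        [ring|f_equal; unfold dot, cross; simpl; ring].
    - apply primitive_on_ext with (3 := primitive_on_dot_const D _ _ (cross d e) HN);
        [reflexivity|].
      intros x Dx; cbv beta; destruct (Rot x Dx) as [_ ->].
      f_equal; transitivity (dot d d * dot (N x) e - dot d e * dot (N x) d);
        [rewrite dd, de; ring|unfold dot, cross; simpl; ring]. }
  assert (C : c = 1 \/ c = -1).
  { assert (Z : (c - 1) * (c + 1) = 0) by lra.
    destruct (Rmult_integral _ _ Z); [left|right]; lra. }
  (* Since [alpha] is [- c] times the wanted angle, the cosine is unaffected and the sine changes by
     [- c], which the second axis compensates. *)
  exists e, (- c).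
  split; [exact ee|split; [exact de|split; [lra|]]].
  intros s Ds; destruct (Turn s Ds) as [Hp Hr]; split.
  - rewrite Hp; unfold alpha; f_equal; destruct C as [-> | ->];
      [rewrite <- cos_neg|]; f_equal; ring.
  - rewrite dot_comm, dot_scale_l, (dot_comm (cross d e)), Hr; unfold alpha.
    destruct C as [-> | ->].
    + replace (-(1) * (1 / n) * acos (m * theta s))
        with (- (1 / n * acos (m * theta s))) by ring.
      rewrite sin_neg; ring.
    + replace (- -1 * (1 / n) * acos (m * theta s))
        with (1 / n * acos (m * theta s)) by ring.
      ring.
Qed.

(** * The position vector in the three parameters *)

Theorem theorem3p4
  (D : R -> Prop) (psi T N : R -> E3) (kappa : R -> R) (phi n m : R)
  (hD : is_interval D)
  (hC4 : Ck_curve 4 D psi)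
  (hpsi : unit_speed_curve D psi T kappa N)
  (hslant : slant_helix D N phi)
  (hn : n = cos phi)
  (hn01 : 0 < Rabs n < 1)
  (hm : m = n / sqrt (1 - n ^ 2)) :
  exists (F : E3 -> E3) (theta : R -> R),
    isometry F /\
    primitive_on D kappa theta /\
    (forall s, D s -> Rabs (m * theta s) < 1) /\
    (* natural representation *)
    (exists A1 A2 P1 P2 P3 : R -> R,
       primitive_on D (fun s => kappa s * cos (1 / n * acos (m * theta s))) A1 /\
       primitive_on D (fun s => kappa s * sin (1 / n * acos (m * theta s))) A2 /\
       primitive_on D A1 P1 /\
       primitive_on D A2 P2 /\
       primitive_on D theta P3 /\
       (forall s, D s ->
          F (psi s) = mkE3 (n / m * P1 s) (n / m * P2 s) (n * P3 s))) /\
    (* parameter u = theta s, with inverse s = sigma u *)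
    (exists sigma : R -> R,
       (forall s, D s -> sigma (theta s) = s) /\
       let J := image D theta in
       exists A1 A2 P1 P2 P3 : R -> R,
         primitive_on J (fun u => cos (1 / n * acos (m * u))) A1 /\
         primitive_on J (fun u => sin (1 / n * acos (m * u))) A2 /\
         primitive_on J (fun u => 1 / kappa (sigma u) * A1 u) P1 /\
         primitive_on J (fun u => 1 / kappa (sigma u) * A2 u) P2 /\
         primitive_on J (fun u => u / kappa (sigma u)) P3 /\
         (forall u, J u ->
            F (psi (sigma u)) = mkE3 (n / m * P1 u) (n / m * P2 u) (n * P3 u))) /\
    (* parameter t = (1/n) arccos (m theta), with inverse s = rho t *)
    (exists rho : R -> R,
       let tau := fun s => 1 / n * acos (m * theta s) in
       (forall s, D s -> rho (tau s) = s) /\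
       let K := image D tau in
       exists A1 A2 P1 P2 P3 : R -> R,
         primitive_on K (fun t => cos t * sin (n * t)) A1 /\
         primitive_on K (fun t => sin t * sin (n * t)) A2 /\
         primitive_on K (fun t => sin (n * t) / kappa (rho t) * A1 t) P1 /\
         primitive_on K (fun t => sin (n * t) / kappa (rho t) * A2 t) P2 /\
         primitive_on K (fun t => sin (n * t) * cos (n * t) / kappa (rho t)) P3 /\
         (forall t, K t ->
            F (psi (rho t)) =
              mkE3 (n ^ 3 / m ^ 3 * P1 t) (n ^ 3 / m ^ 3 * P2 t)
                   (- (n ^ 2 / m ^ 2) * P3 t))).
Proof.
  destruct hpsi as [T' [Hpsi [HT HF]]].
  destruct hslant as [d [Hd HNd]].
  assert (n0 : n <> 0) by (intros ->; rewrite Rabs_R0 in hn01; lra).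
  assert (nn : 0 < 1 - n * n).
  { destruct hn01 as [_ h]; apply Rabs_def2 in h; destruct h; nra. }
  set (q := sqrt (1 - n ^ 2)) in *.
  assert (Hq : 0 < q) by (apply sqrt_lt_R0; lra).
  assert (Hqq : q * q = 1 - n * n) by (unfold q; rewrite sqrt_sqrt; lra).
  assert (m0 : m <> 0).
  { rewrite hm; apply Rmult_integral_contrapositive_currified; [exact n0|].
    apply Rinv_neq_0_compat; lra. }
  assert (nm : n / m = q) by (rewrite hm; field; lra).
  assert (TT : forall s, D s -> dot (T s) (T s) = 1).
  { intros s Ds; destruct (HF s Ds) as [E _]; rewrite dot_self_enorm, E; ring. }
  assert (Hk : forall s, D s -> 0 < kappa s) by (intros s Ds; apply HF, Ds).
  assert (T'E : forall s, D s -> T' s = scale (kappa s) (N s)).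
  { intros s Ds; destruct (HF s Ds) as [_ [_ [k0 ->]]].
    unfold scale; destruct (T' s); simpl; f_equal; field; lra. }
  assert (NN : forall s, D s -> dot (N s) (N s) = 1).
  { intros s Ds; destruct (HF s Ds) as [_ [kE [k0 ->]]].
    rewrite dot_scale_l, dot_comm, dot_scale_l, dot_self_enorm, <- kE; field; lra. }
  assert (HTN : curve_deriv_on D T (fun s => scale (kappa s) (N s))).
  { apply (curve_deriv_ext D T T'); auto; intros s Ds; now rewrite T'E. }
  (* The argument [1] reads the order 4 as [3 + 1]. *)
  destruct (principal_normal_derivable 1 D psi T T' hD hC4 Hpsi HT) as [N' HN'].
  { intros s Ds; destruct (HF s Ds) as [_ [<- [k0 _]]]; exact k0. }
  assert (HN : curve_deriv_on D N N').
  { apply (curve_deriv_ext D _ _ N N') with (3 := HN'); [|reflexivity].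
    intros s Ds; destruct (HF s Ds) as [_ [<- [_ E]]]; exact E. }
  assert (dd : dot d d = 1) by (rewrite dot_self_enorm, Hd; ring).
  assert (Nd : forall s, D s -> dot (N s) d = n).
  { intros s Ds; rewrite hn; auto. }
  (* This fixes the constant of integration of [theta] for all three representations. *)
  set (theta := fun s => dot (T s) d / n).
  destruct (slant_helix_frame D T N N' kappa d n q m theta hD HTN HN TT NN Hk dd Nd
    n0 Hq Hqq hm (fun s => eq_refl)) as [Hth [Hb [e [c [ee [de [cc Hang]]]]]]].
  set (e2 := scale c (cross d e)) in *.
  exists (fun u => mkE3 (dot u e) (dot u e2) (dot u d)), theta.
  split; [now apply orthonormal_frame_isometry|].
  split; [exact Hth|split; [exact Hb|]].
  set (tau := fun s => 1 / n * acos (m * theta s)) in *.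
  (* As [T' = kappa N], a frame coordinate [q * f] of [N] makes [/ q * dot (T s) w] an
     antiderivative of [kappa * f]. All inner and outer integrals below are such multiples of
     coordinates of [T] and [psi]. *)
  assert (HA : forall w f, (forall s, D s -> dot (N s) w = q * f s) ->
    primitive_on D (fun s => kappa s * f s) (fun s => / q * dot (T s) w)).
  { intros w f Hf.
    apply primitive_on_ext
      with (3 := primitive_on_scal D (/ q) _ _ (primitive_on_dot_const D _ _ w HTN));
      [reflexivity|].
    intros s Ds; rewrite dot_scale_l, Hf by exact Ds; field; lra. }
  assert (HA1 := HA e (fun s => cos (tau s)) (fun s Ds => proj1 (Hang s Ds))).
  assert (HA2 := HA e2 (fun s => sin (tau s)) (fun s Ds => proj2 (Hang s Ds))).
  cbv beta in HA1, HA2.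
  assert (HP : forall w, primitive_on D (fun s => / q * dot (T s) w)
    (fun s => / q * dot (psi s) w)).
  { intro w; apply primitive_on_scal, primitive_on_dot_const; exact Hpsi. }
  assert (HP3 : primitive_on D theta (fun s => / n * dot (psi s) d)).
  { apply primitive_on_ext
      with (3 := primitive_on_scal D (/ n) _ _ (primitive_on_dot_const D _ _ d Hpsi));
      [reflexivity|].
    intros s _; unfold theta, Rdiv; ring. }
  split; [|split].
  - exists (fun s => / q * dot (T s) e), (fun s => / q * dot (T s) e2),
      (fun s => / q * dot (psi s) e), (fun s => / q * dot (psi s) e2),
      (fun s => / n * dot (psi s) d).
    repeat (split; [solve [auto]|]).
    intros s Ds; rewrite nm; f_equal; field; lra.
  (* Here [theta] has derivative [kappa > 0], so the previous antiderivatives are composed with its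
     inverse and each integrand is divided by [kappa]. *)
  - assert (Hmono : strictly_monotone_on D theta).
    { left; apply (primitive_on_increasing D theta kappa); auto. }
    destruct (monotone_left_inverse D theta Hmono) as [sigma Hs].
    exists sigma; split; [exact Hs|]; cbv zeta.
    exists (fun u => / q * dot (T (sigma u)) e), (fun u => / q * dot (T (sigma u)) e2),
      (fun u => / q * dot (psi (sigma u)) e), (fun u => / q * dot (psi (sigma u)) e2),
      (fun u => / n * dot (psi (sigma u)) d).
    assert (k0 : forall s, D s -> kappa s <> 0).
    { intros s Ds; apply Rgt_not_eq, Hk, Ds. }
    assert (Rep := fun g G k =>
      primitive_on_reparam D theta kappa sigma g G k hD Hmono Hth k0 Hs).
    split; [|split; [|split; [|split; [|split]]]].
    + apply (Rep _ _ _ HA1); intros s Ds; unfold tau; field; auto.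
    + apply (Rep _ _ _ HA2); intros s Ds; unfold tau; field; auto.
    + apply (Rep _ _ _ (HP e)); intros s Ds; rewrite Hs by exact Ds; field.
      split; auto; lra.
    + apply (Rep _ _ _ (HP e2)); intros s Ds; rewrite Hs by exact Ds; field.
      split; auto; lra.
    + apply (Rep _ _ _ HP3); intros s Ds; rewrite Hs by exact Ds; reflexivity.
    + intros u _; rewrite nm; f_equal; field; lra.
  - assert (Hm1 : forall s, D s -> -1 < m * theta s < 1).
    { intros s Ds; specialize (Hb s Ds); apply Rabs_def2 in Hb; destruct Hb; lra. }
    assert (ntau : forall s, n * tau s = acos (m * theta s)).
    { intro s; unfold tau; field; exact n0. }
    assert (Hcos : forall s, D s -> cos (n * tau s) = m * theta s).
    { intros s Ds; rewrite ntau; apply cos_acos; specialize (Hm1 s Ds); lra. }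
    assert (Hsin : forall s, D s -> sqrt (1 - Rsqr (m * theta s)) = sin (n * tau s)).
    { intros s Ds; rewrite ntau; symmetry; apply sin_acos; specialize (Hm1 s Ds); lra. }
    (* The angle [n * tau s] is an arccosine of a number strictly between -1 and 1, so its sine is a
       positive square root. *)
    assert (Spos : forall s, D s -> 0 < sin (n * tau s)).
    { intros s Ds; rewrite <- Hsin by exact Ds; apply sqrt_lt_R0.
      specialize (Hm1 s Ds); unfold Rsqr; nra. }
    assert (S0 : forall s, D s -> sin (n * tau s) <> 0).
    { intros s Ds; apply Rgt_not_eq, Spos, Ds. }
    (* Chain rule for the arccosine, with [m / n = / q]; the negative sign makes [tau]
       decreasing. *)
    set (tau' := fun s => - (kappa s / (q * sin (n * tau s)))).
    assert (Htau : primitive_on D tau' tau).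
    { eapply primitive_on_ext; [| |apply (primitive_on_scal D (1 / n));
        apply (primitive_on_comp D (fun s => m * theta s) _ acos
          (fun y => -1 / sqrt (1 - Rsqr y)) (primitive_on_scal D m _ _ Hth));
        intros s Ds; apply derivable_pt_lim_acos; auto].
      - reflexivity.
      - intros s Ds; unfold tau'; cbv beta; rewrite (Hsin s Ds), hm.
        field; repeat split; auto; lra. }
    assert (tau'neg : forall s, D s -> 0 < -1 * tau' s).
    { intros s Ds; unfold tau'.
      replace (-1 * - (kappa s / (q * sin (n * tau s))))
        with (kappa s / (q * sin (n * tau s))) by ring.
      apply Rdiv_lt_0_compat; [|apply Rmult_lt_0_compat]; auto. }
    assert (tau'0 : forall s, D s -> tau' s <> 0).
    { intros s Ds; specialize (tau'neg s Ds); lra. }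
    assert (Hmono : strictly_monotone_on D tau).
    { right; apply (primitive_on_increasing D _ (fun s => -1 * tau' s)); auto.
      apply primitive_on_ext with (3 := primitive_on_scal D (-1) _ _ Htau);
        [intros s _; ring|reflexivity]. }
    destruct (monotone_left_inverse D tau Hmono) as [rho Hr].
    exists rho; cbv zeta; split; [exact Hr|].
    fold tau.
    (* Since [sin (n * t) dt = - (kappa / q) ds], each integration contributes a factor [- / q]:
       once for the inner integrals, twice for the outer ones. In the third coordinate
       [cos (n * t) = m * theta] adds the factor [m]. *)
    exists (fun t => - / q * (/ q * dot (T (rho t)) e)),
      (fun t => - / q * (/ q * dot (T (rho t)) e2)),
      (fun t => / (q * q) * (/ q * dot (psi (rho t)) e)),
      (fun t => / (q * q) * (/ q * dot (psi (rho t)) e2)),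
      (fun t => - (m / q) * (/ n * dot (psi (rho t)) d)).
    assert (k0 : forall s, D s -> kappa s <> 0).
    { intros s Ds; apply Rgt_not_eq, Hk, Ds. }
    assert (Rep : forall g G k a, primitive_on D g G ->
      (forall s, D s -> k (tau s) = a * g s / tau' s) ->
      primitive_on (image D tau) k (fun t => a * G (rho t))).
    { intros g G k a HG Hkk.
      exact (primitive_on_reparam D tau tau' rho _ _ k hD Hmono Htau tau'0 Hr
        (primitive_on_scal D a G g HG) Hkk). }
    split; [|split; [|split; [|split; [|split]]]].
    + apply (Rep _ _ _ _ HA1); intros s Ds; unfold tau'.
      field; repeat split; auto; lra.
    + apply (Rep _ _ _ _ HA2); intros s Ds; unfold tau'.
      field; repeat split; auto; lra.
    + apply (Rep _ _ _ _ (HP e)); intros s Ds; rewrite Hr by exact Ds; unfold tau'.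
      field; repeat split; auto; lra.
    + apply (Rep _ _ _ _ (HP e2)); intros s Ds; rewrite Hr by exact Ds; unfold tau'.
      field; repeat split; auto; lra.
    + apply (Rep _ _ _ _ HP3); intros s Ds; rewrite Hr, Hcos by exact Ds; unfold tau'.
      field; repeat split; auto; lra.
    + intros t _.
      (* With [n / m = q], the prefactors cancel the powers of [q] put into the antiderivatives. *)
      replace (n ^ 3 / m ^ 3) with ((n / m) ^ 3) by (field; exact m0).
      replace (n ^ 2 / m ^ 2) with ((n / m) ^ 2) by (field; exact m0).
      rewrite nm, hm; f_equal; field; lra.
Qed.
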